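(* Let $H_1, \ldots, H_k$ be disjoint vertex-induced subgraphs of a graph $G$. Then $$ s^+(G)\geq \sum_{i=1}^{k} s^+(H_i)\quad \text{ and }\quad s^-(G)\geq \sum_{i=1}^{k} s^-(H_i),$$ and equality holds in both simultaneously if and only if $G$ is the disjoint union of $H_1, \ldots, H_k$.
   Context: All graphs are finite and simple (undirected, no loops or multiple edges). For a graph $G$ of order $n$ (i.e. with $n$ vertices), let $A(G)$ be its $n\times n$ adjacency matrix, with $(i,j)$ entry $1$ if the vertices $v_i$ and $v_j$ are adjacent and $0$ otherwise. The eigenvalues of $G$ are the eigenvalues of $A(G)$, which are real; list them with multiplicity as $\lambda_1(G)\ge\cdots\ge\lambda_n(G)$. The positive square energy and the negative square energy of $G$ are $$s^+(G)=\sum_{\lambda_i(G)>0}\lambda_i(G)^2,\qquad s^-(G)=\sum_{\lambda_i(G)<0}\lambda_i(G)^2.$$ A vertex-induced subgraph of $G$ is the subgraph $G[S]$ for some $S\subseteq V(G)$, with vertex set $S$ and all edges of $G$ having both ends in $S$. The subgraphs $H_1,\ldots,H_k$ are disjoint if their vertex sets are pairwise disjoint. The graph $G$ is the disjoint union of $H_1,\ldots,H_k$ if $V(G)$ is the disjoint union of the sets $V(H_i)$ and $E(G)=\bigcup_i E(H_i)$, i.e. there are no edges of $G$ between different $V(H_i)$.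
   Formalization: The equality clause fails if G has an isolated vertex outside all H_i; it is proved as: equality in both iff every edge of G lies in some H_i, and iff G is the disjoint union of the H_i when no vertex outside the H_i is isolated in G. *)

(* Defs.v *)
From mathcomp Require Import all_boot all_order all_algebra.

Set Implicit Arguments.
Unset Strict Implicit.
Unset Printing Implicit Defensive.

Import Order.TTheory GRing.Theory Num.Theory.
Local Open Scope ring_scope.

Record sgraph := SGraph {
  vertex :> finType;
  edge : rel vertex;
  edge_sym : symmetric edge;
  edge_irrefl : irreflexive edge
}.

Section Induced.
Variables (G : sgraph) (S : {set G}).

Definition induced_edge : rel {x : G | x \in S} :=
  fun x y => edge (val x) (val y).

Lemma induced_edge_sym : symmetric induced_edge.
Proof. by move=> x y; apply: edge_sym. Qed.

Lemma induced_edge_irrefl : irreflexive induced_edge.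
Proof. by move=> x; apply: edge_irrefl. Qed.

Definition induced : sgraph := SGraph induced_edge_sym induced_edge_irrefl.

End Induced.

(* E(G) is the union of the E(G[S_i]); the S_i need not cover V(G). *)
Definition edges_covered (G : sgraph) (k : nat) (S : 'I_k -> {set G}) : Prop :=
  forall x y : G, edge x y <-> exists i, [/\ x \in S i, y \in S i & edge x y].

Definition disjoint_union (G : sgraph) (k : nat) (S : 'I_k -> {set G}) : Prop :=
  [/\ \bigcup_(i < k) S i = [set: G],
      forall i j, i != j -> [disjoint S i & S j]
    & edges_covered S].

Definition isolated (G : sgraph) (v : G) : Prop := forall w : G, ~~ edge v w.

(* A numClosedFieldType is only partially ordered: [0 < x] and [x < 0] both
   entail that [x] is real. *)
Section Energy.
Variable C : numClosedFieldType.

Definition adjmx (G : sgraph) : 'M[C]_#|G| :=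
  \matrix_(i, j) (edge (enum_val i) (enum_val j))%:R.

(* The roots of the characteristic polynomial, listed with multiplicity. *)
Definition eigenvalues n (A : 'M[C]_n) : seq C :=
  sval (closed_field_poly_normal (char_poly A)).

Definition s_plus (G : sgraph) : C :=
  \sum_(l <- eigenvalues (adjmx G) | 0 < l) l ^+ 2.

Definition s_minus (G : sgraph) : C :=
  \sum_(l <- eigenvalues (adjmx G) | l < 0) l ^+ 2.

Lemma char_poly_eigenvalues n (A : 'M[C]_n) :
  char_poly A = \prod_(l <- eigenvalues A) ('X - l%:P).
Proof.
rewrite /eigenvalues; case: closed_field_poly_normal => r /= {1}->.
by rewrite (monicP (char_poly_monic A)) scale1r.
Qed.

Lemma size_eigenvalues n (A : 'M[C]_n) : size (eigenvalues A) = n.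
Proof.
by have := size_char_poly A; rewrite char_poly_eigenvalues size_prod_XsubC => -[].
Qed.

Lemma eigenvalues_adjmx_real (G : sgraph) :
  {in eigenvalues (adjmx G), forall l, l \is Num.real}.
Proof.
move=> l; rewrite -root_prod_XsubC -char_poly_eigenvalues -eigenvalue_root_char.
case/eigenvalueP => v vA v_neq0; set A := adjmx G in vA.
pose w := map_mx Num.conj v^T.
have Aconj : map_mx Num.conj A^T = A.
  by apply/matrixP => i j; rewrite !mxE rmorph_nat edge_sym.
have wA : A *m w = l^* *: w.
  by rewrite -{1}Aconj -map_mxM -trmx_mul vA linearZ /= map_mxZ.
have vw : (v *m w) 0 0 != 0.
  case/rV0Pn: v_neq0 => j vj; rewrite mxE psumr_neq0 => [|i _]; last first.
    by rewrite !mxE mul_conjC_ge0.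
  by apply/hasP; exists j; rewrite ?mem_index_enum //= !mxE mul_conjC_gt0.
have : v *m A *m w = v *m (A *m w) by rewrite mulmxA.
rewrite vA wA -scalemxAl -scalemxAr => /matrixP/(_ 0 0).
by rewrite [LHS]mxE [RHS]mxE => /(mulIf vw) /esym /CrealP.
Qed.

End Energy.

(* Main.v *)
Require Import Defs.
From mathcomp Require Import all_boot all_order all_algebra.
From mathcomp Require Import ring.

Set Implicit Arguments.
Unset Strict Implicit.
Unset Printing Implicit Defensive.

Import Order.TTheory GRing.Theory Num.Theory.
Local Open Scope ring_scope.
Local Open Scope sesquilinear_scope.

(** A Hermitian matrix A splits as P - N, with P and N positive semidefinite and
    P N = 0, by keeping the positive, respectively the negative, eigenvalues in a
    spectral decomposition ([hermitian_jordan]). The square energies of A are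
    then the squared Frobenius norms of P and N.

    Passing to a principal submatrix A_i of A gives A_i = P_i - N_i with P_i and
    N_i still positive semidefinite, although their product need not vanish. The
    point is that among all ways of writing a Hermitian matrix as a difference
    of positive semidefinite matrices, the orthogonal one has both Frobenius
    norms minimal ([frob2_jordan_min]). So the positive square energy of A_i is
    at most the squared norm of P_i. For disjoint vertex sets the P_i are
    disjoint diagonal blocks of P, whence the sum of their squared norms is at
    most that of P; the same goes for N. This gives both inequalities
    ([sum_energy_le]).

    For the equality case, the two square energies of A add up to the squared
    Frobenius norm of A ([energy_split]), which for an adjacency matrix is twice
    the number of edges. Given the two inequalities, equality in both amounts to
    equality of their sums, that is, no edge of G lies outside the induced
    subgraphs ([energy_eq_edges_covered]). The vertex sets then exhaust G up to
    isolated vertices, which contribute nothing to either energy. *)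

Section Energy.
Variable C : numClosedFieldType.

(** * Traces and positive semidefinite matrices *)

Definition frob2 m n (M : 'M[C]_(m, n)) : C := \sum_i \sum_j `|M i j| ^+ 2.

Definition pos_energy n (A : 'M[C]_n) : C :=
  \sum_(l <- eigenvalues A | 0 < l) l ^+ 2.

Definition neg_energy n (A : 'M[C]_n) : C :=
  \sum_(l <- eigenvalues A | l < 0) l ^+ 2.

(** Positive semidefiniteness is encoded by a Gram factorization: it passes to
    principal submatrices by selecting columns of the factor. The factor may be
    rectangular so that such a selection is again a factor. *)
Definition psdmx n (P : 'M[C]_n) : Prop :=
  exists m (B : 'M[C]_(m, n)), P = B ^t* *m B.

Lemma adjointM m n p (A : 'M[C]_(m, n)) (B : 'M[C]_(n, p)) :
  (A *m B) ^t* = B ^t* *m A ^t*.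
Proof. by rewrite trmx_mul map_mxM. Qed.

Lemma trace_mul_adjoint m n (M : 'M[C]_(m, n)) :
  \tr (M *m M ^t*) = frob2 M.
Proof.
by apply: eq_bigr => i _; rewrite mxE; apply: eq_bigr => j _; rewrite !mxE normCK.
Qed.

Lemma frob2_hermitian n (M : 'M[C]_n) : M ^t* = M -> frob2 M = \tr (M *m M).
Proof. by move=> herM; rewrite -[in RHS]herM {1}herM trace_mul_adjoint. Qed.

Lemma frob2_ge0 m n (M : 'M[C]_(m, n)) : 0 <= frob2 M.
Proof. by do 2!apply: sumr_ge0 => ? _; rewrite exprn_ge0. Qed.

Lemma psdmx_hermitian n (P : 'M[C]_n) : psdmx P -> P ^t* = P.
Proof. by case=> m [B ->]; rewrite adjointM trmxCK. Qed.

Lemma psdmx_principal n p (f : 'I_p -> 'I_n) (P : 'M[C]_n) :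
  psdmx P -> psdmx (mxsub f f P).
Proof.
by case=> m [B ->]; exists m, (colsub f B); rewrite mxsub_mul trmx_mxsub map_mxsub.
Qed.

(** With P = B^* B and Q = D^* D, cyclicity turns the trace into the squared
    Frobenius norm of D B^*. *)
Lemma psdmx_trace_mul_ge0 n (P Q : 'M[C]_n) :
  psdmx P -> psdmx Q -> 0 <= \tr (P *m Q).
Proof.
case=> [m [B ->]] [p [D ->]].
have -> : \tr (B ^t* *m B *m (D ^t* *m D)) = \tr ((D *m B ^t*) *m (D *m B ^t*) ^t*).
  by rewrite adjointM trmxCK -[in RHS]mulmxA [RHS]mxtrace_mulC !mulmxA.
by rewrite trace_mul_adjoint frob2_ge0.
Qed.

(** Orthogonality gives tr P'^2 = tr P'(P' - N') = tr P'(P - N), hence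
    tr P^2 - tr P'^2 = |P - P'|^2 + 2 tr P'N, a sum of nonnegative terms. *)
Lemma frob2_jordan_min n (P N P' N' : 'M[C]_n) :
    psdmx P -> psdmx N -> psdmx P' ->
    \tr (P' *m N') = 0 -> P' - N' = P - N ->
  frob2 P' <= frob2 P.
Proof.
move=> psdP psdN psdP' tr0 eqA.
have := frob2_ge0 (P - P'); have := psdmx_trace_mul_ge0 psdP' psdN.
have [herP herP'] := (psdmx_hermitian psdP, psdmx_hermitian psdP').
have herD : (P - P') ^t* = P - P' by rewrite linearB /= map_mxB herP herP'.
rewrite !frob2_hermitian //.
have trP' : \tr (P' *m P') = \tr (P' *m P) - \tr (P' *m N).
  by rewrite -linearB -mulmxBr /= -eqA mulmxBr linearB /= tr0 subr0.
rewrite mulmxBl !mulmxBr !linearB /= (mxtrace_mulC P P') trP'.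
set a := \tr (P *m P); set b := \tr (P' *m P); set c := \tr (P' *m N).
move=> c_ge0 D_ge0; rewrite -subr_ge0.
have -> : a - (b - c) = (a - b - (b - (b - c))) + c *+ 2 by ring.
by rewrite addr_ge0 // mulrn_wge0.
Qed.

(** * Spectral decomposition of a Hermitian matrix *)

Lemma char_poly_unitary_conj n (Q M : 'M[C]_n) :
  Q *m Q ^t* = 1%:M -> char_poly (Q ^t* *m M *m Q) = char_poly M.
Proof.
move=> QQ; rewrite /char_poly.
have QtQ : Q ^t* *m Q = 1%:M by apply: mulmx1C.
have -> : char_poly_mx (Q ^t* *m M *m Q) =
    map_mx polyC (Q ^t*) *m char_poly_mx M *m map_mx polyC Q.
  rewrite /char_poly_mx mulmxBr mulmxBl !map_mxM; congr (_ - _).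
  by rewrite scalar_mxC -mulmxA -map_mxM QtQ map_mx1 mulmx1.
by rewrite !det_mulmx mulrAC -det_mulmx -map_mxM QtQ map_mx1 det1 mul1r.
Qed.

(** For a unitary Q, the matrices diagonal in the orthonormal basis given by the
    rows of Q. If A = spectral_comb Q d, changing d amounts to applying a
    function to A. *)
Definition spectral_comb n (Q : 'M[C]_n) (d : 'I_n -> C) : 'M[C]_n :=
  Q ^t* *m diag_mx (\row_j d j) *m Q.

Section SpectralComb.
Variables (n : nat) (Q : 'M[C]_n).
Hypothesis unitaryQ : Q *m Q ^t* = 1%:M.

Lemma spectral_combM (d e : 'I_n -> C) :
  spectral_comb Q d *m spectral_comb Q e = spectral_comb Q (fun j => d j * e j).
Proof.
rewrite /spectral_comb -!mulmxA [Q *m (Q ^t* *m _)]mulmxA unitaryQ mul1mx.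
congr (_ *m _); rewrite mulmxA mulmx_diag; congr (diag_mx _ *m _).
by apply/rowP => j; rewrite !mxE.
Qed.

Lemma spectral_combB (d e : 'I_n -> C) :
  spectral_comb Q d - spectral_comb Q e = spectral_comb Q (fun j => d j - e j).
Proof.
rewrite /spectral_comb -mulmxBl -mulmxBr -linearB /=.
by congr (_ *m diag_mx _ *m _); apply/rowP => j; rewrite !mxE.
Qed.

Lemma trace_spectral_comb (d : 'I_n -> C) : \tr (spectral_comb Q d) = \sum_j d j.
Proof.
rewrite /spectral_comb mxtrace_mulC mulmxA unitaryQ mul1mx mxtrace_diag.
by apply: eq_bigr => j _; rewrite mxE.
Qed.

Lemma psdmx_spectral_comb (d : 'I_n -> C) :
  (forall j, 0 <= d j) -> psdmx (spectral_comb Q d).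
Proof.
move=> d_ge0; exists n, (diag_mx (\row_j sqrtC (d j)) *m Q).
rewrite adjointM tr_diag_mx map_diag_mx -!mulmxA [diag_mx _ *m (_ *m _)]mulmxA.
rewrite mulmx_diag /spectral_comb -mulmxA; congr (_ *m (diag_mx _ *m _)).
apply/rowP => j; rewrite !mxE -[LHS]sqrtCK expr2; congr (_ * _).
by apply/esym/CrealP/ger0_real; rewrite sqrtC_ge0.
Qed.

(** The list [eigenvalues] is an arbitrary list of roots of the characteristic
    polynomial, so it is determined only up to order. *)
Lemma perm_eigenvalues_spectral_comb (d : 'I_n -> C) :
  perm_eq (eigenvalues (spectral_comb Q d)) [seq d j | j <- index_enum 'I_n].
Proof.
apply: prod_XsubC_eq; rewrite -char_poly_eigenvalues big_map.
rewrite char_poly_unitary_conj // char_poly_trig ?diag_mx_is_trig //.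
by apply: eq_bigr => j _; rewrite !mxE eqxx.
Qed.

End SpectralComb.

(** The Jordan decomposition of A into its positive and negative parts, obtained
    by truncating the spectrum at zero. *)
Lemma hermitian_jordan n (A : 'M[C]_n) : A ^t* = A ->
  exists P N, [/\ psdmx P, psdmx N, A = P - N, \tr (P *m N) = 0
    & pos_energy A = frob2 P /\ neg_energy A = frob2 N].
Proof.
move=> herA.
have herA' : A \is hermsymmx by apply/is_hermitianmxP; rewrite expr0 scale1r herA.
pose Q := spectralmx A; pose d j := spectral_diag A 0 j.
have QQ : Q *m Q ^t* = 1%:M by apply/unitarymxP/spectral_unitarymx.
have d_real j : d j \is Num.real.
  by have /mxOverP := hermitian_spectral_diag_real herA'; apply.
have AE : A = spectral_comb Q d.
  have /orthomx_spectralP {1}-> := hermitian_normalmx herA'.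
  rewrite invmx_unitary ?spectral_unitarymx //; congr (_ *m diag_mx _ *m _).
  by apply/rowP => j; rewrite mxE.
pose p j := if 0 < d j then d j else 0; pose q j := if d j < 0 then - d j else 0.
have p_ge0 j : 0 <= p j by rewrite /p; case: ifP => // /ltW.
have q_ge0 j : 0 <= q j by rewrite /q; case: ifP => //; rewrite oppr_ge0 => /ltW.
have psdP := psdmx_spectral_comb Q p_ge0.
have psdN := psdmx_spectral_comb Q q_ge0.
have energyE (r : pred C) :
    \sum_(l <- eigenvalues A | r l) l ^+ 2 =
      \sum_j (if r (d j) then d j ^+ 2 else 0).
  rewrite AE (perm_big _ (perm_eigenvalues_spectral_comb QQ d)) big_map.
  by rewrite big_mkcond.
exists (spectral_comb Q p), (spectral_comb Q q); split => //.
- rewrite spectral_combB AE /spectral_comb; congr (_ *m diag_mx _ *m _).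
  apply/rowP => j; rewrite !mxE /p /q.
  by case: (real_ltgt0P (d_real j)) => [||->]; rewrite ?subr0 // sub0r ?oppr0 ?opprK.
- rewrite spectral_combM // trace_spectral_comb // big1 // => j _; rewrite /p /q.
  by case: (real_ltgt0P (d_real j)) => _; rewrite ?mulr0 ?mul0r.
- rewrite !frob2_hermitian; try exact: psdmx_hermitian.
  rewrite !spectral_combM // !trace_spectral_comb //.
  split; rewrite [LHS]energyE; apply: eq_bigr => j _; rewrite ?/p ?/q.
    by case: ifP; rewrite ?mulr0 // expr2.
  by case: ifP; rewrite ?mulr0 // mulrNN expr2.
Qed.

(** The cross terms of tr (P - N)^2 vanish, P and N being orthogonal. *)
Lemma energy_split n (A : 'M[C]_n) : A ^t* = A ->
  pos_energy A + neg_energy A = frob2 A.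
Proof.
move=> herA; have [P [N [psdP psdN AE trPN [-> ->]]]] := hermitian_jordan herA.
rewrite (frob2_hermitian herA) !frob2_hermitian; try exact: psdmx_hermitian.
rewrite AE mulmxBl !mulmxBr !linearB /= (mxtrace_mulC N P) trPN subr0 sub0r.
by rewrite opprK.
Qed.

(** P and N are the positive and negative parts of A. They are chosen before the
    submatrix, so that the bounds for several blocks can be summed. *)
Lemma principal_energy n (A : 'M[C]_n) : A ^t* = A ->
  exists P N : 'M[C]_n, [/\ pos_energy A = frob2 P, neg_energy A = frob2 N &
    forall m (f : 'I_m -> 'I_n), pos_energy (mxsub f f A) <= frob2 (mxsub f f P) /\
      neg_energy (mxsub f f A) <= frob2 (mxsub f f N)].
Proof.
move=> herA; have [P [N [psdP psdN AE _ [posA negA]]]] := hermitian_jordan herA.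
exists P, N; split=> // m f.
have herAf : (mxsub f f A) ^t* = mxsub f f A by rewrite trmx_mxsub map_mxsub herA.
have [P' [N' [psdP' psdN' AfE trPN' [-> ->]]]] := hermitian_jordan herAf.
have [psdPf psdNf] := (psdmx_principal f psdP, psdmx_principal f psdN).
have eqAf : P' - N' = mxsub f f P - mxsub f f N.
  by rewrite -AfE AE; apply/matrixP => i j; rewrite !mxE.
split; first exact: frob2_jordan_min eqAf.
(* - A = N - P is a difference of the same two matrices, in the other order. *)
apply: (frob2_jordan_min (N' := P') psdNf psdPf psdN').
  by rewrite mxtrace_mulC trPN'.
by rewrite -opprB eqAf opprB.
Qed.

(** * Disjoint induced subgraphs *)

(** Adjacency matrices are indexed by ordinals through an enumeration of the
    vertices; this translates the enumeration of G[S] into that of G. *)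
Definition ord_of_induced (G : sgraph) (S : {set G}) (a : 'I_#|induced S|) :
  'I_#|G| := enum_rank (val (enum_val a)).
Arguments ord_of_induced {G} S a.

Lemma adjmx_induced (G : sgraph) (S : {set G}) :
  adjmx C (induced S) =
  mxsub (ord_of_induced S) (ord_of_induced S) (adjmx C G).
Proof. by apply/matrixP => a b; rewrite !mxE !enum_rankK. Qed.

Lemma adjmx_hermitian (G : sgraph) : (adjmx C G) ^t* = adjmx C G.
Proof. by apply/matrixP => a b; rewrite !mxE rmorph_nat edge_sym. Qed.

Lemma frob2_vertices (G : sgraph) (M : 'M[C]_#|G|) :
  frob2 M = \sum_(x : G) \sum_(y : G) `|M (enum_rank x) (enum_rank y)| ^+ 2.
Proof.
rewrite /frob2 [RHS]big_enum_val; apply: eq_bigr => a _.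
rewrite [RHS]big_enum_val; apply: eq_bigr => b _.
by rewrite !enum_valK.
Qed.

Lemma frob2_induced (G : sgraph) (S : {set G}) (M : 'M[C]_#|G|) :
  frob2 (mxsub (ord_of_induced S) (ord_of_induced S) M) =
  \sum_(x in S) \sum_(y in S) `|M (enum_rank x) (enum_rank y)| ^+ 2.
Proof.
rewrite frob2_vertices [RHS]big_sub; apply: eq_bigr => u _.
rewrite [RHS]big_sub; apply: eq_bigr => v _.
by rewrite mxE /ord_of_induced !enum_rankK.
Qed.

Section Blocks.
Context {T : finType} {k : nat}.
Variable S : 'I_k -> {set T}.
Hypothesis disjS : forall i j : 'I_k, i != j -> [disjoint S i & S j].

Definition same_block (x y : T) := [exists i, (x \in S i) && (y \in S i)].

(** By disjointness, a pair of points lies in at most one square S_i x S_i. *)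
Lemma sum_blocks (F : T -> T -> C) :
  \sum_i \sum_(x in S i) \sum_(y in S i) F x y =
  \sum_x \sum_(y | same_block x y) F x y.
Proof.
under eq_bigr => i _ do rewrite big_mkcond.
rewrite exchange_big /=; apply: eq_bigr => x _.
have guard i : (if x \in S i then \sum_(y in S i) F x y else 0) =
    \sum_y (if (x \in S i) && (y \in S i) then F x y else 0).
  by case: ifP => _; rewrite ?big1_eq // big_mkcond.
under eq_bigr => i _ do rewrite guard.
rewrite exchange_big [RHS]big_mkcond /=; apply: eq_bigr => y _.
case: ifP => [/existsP[i xyi] | /existsPn noblock]; last first.
  by rewrite big1 // => i _; rewrite ifN.
rewrite (bigD1 i) //= xyi big1 ?addr0 // => j ji; rewrite ifN //.
case/andP: xyi => xi _; apply: contraTN xi => /andP[xj _].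
by rewrite (disjointFr (disjS ji) xj).
Qed.

(** The last sum runs over the entries lost when only the diagonal blocks are
    kept. *)
Lemma sum_blocks_compl (F : T -> T -> C) :
  \sum_x \sum_y F x y = \sum_i \sum_(x in S i) \sum_(y in S i) F x y
    + \sum_x \sum_(y | ~~ same_block x y) F x y.
Proof.
rewrite sum_blocks -big_split; apply: eq_bigr => x _ /=.
by rewrite [LHS](bigID (same_block x)).
Qed.

End Blocks.

Section Graph.
Variables (G : sgraph) (k : nat) (S : 'I_k -> {set G}).
Hypothesis disjS : forall i j : 'I_k, i != j -> [disjoint S i & S j].

Lemma frob2_blocks_le (M : 'M[C]_#|G|) :
  \sum_i frob2 (mxsub (ord_of_induced (S i)) (ord_of_induced (S i)) M)
    <= frob2 M.
Proof.
under eq_bigr => i _ do rewrite frob2_induced.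
rewrite frob2_vertices (sum_blocks_compl disjS) lerDl.
by do 2!apply: sumr_ge0 => ? _; rewrite exprn_ge0.
Qed.

Lemma sum_energy_le :
  \sum_i s_plus C (induced (S i)) <= s_plus C G /\
  \sum_i s_minus C (induced (S i)) <= s_minus C G.
Proof.
have [P [N [posG negG le_f]]] := principal_energy (adjmx_hermitian G).
rewrite [s_plus C G]posG [s_minus C G]negG.
split; apply: le_trans (frob2_blocks_le _); apply: ler_sum => i _.
  by rewrite /s_plus adjmx_induced; have [] := le_f _ (ord_of_induced (S i)).
by rewrite /s_minus adjmx_induced; have [] := le_f _ (ord_of_induced (S i)).
Qed.

(** Both sides are sums of squared adjacency entries, that on the right being
    restricted to the diagonal blocks; they agree when the lost entries, which
    are nonnegative, all vanish. *)
Lemma energy_eq_edges_covered :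
  s_plus C G + s_minus C G =
    \sum_i (s_plus C (induced (S i)) + s_minus C (induced (S i))) <->
  edges_covered S.
Proof.
have energyE i : s_plus C (induced (S i)) + s_minus C (induced (S i)) =
    \sum_(x in S i) \sum_(y in S i) `|adjmx C G (enum_rank x) (enum_rank y)| ^+ 2.
  by rewrite [LHS](energy_split (adjmx_hermitian _)) adjmx_induced frob2_induced.
rewrite [s_plus C G + _](energy_split (adjmx_hermitian G)).
under eq_bigr => i _ do rewrite energyE.
rewrite frob2_vertices (sum_blocks_compl disjS) -[X in _ = X]addr0.
split=> [/addrI lost0 x y | covered].
  split=> [xy | [i []] //].
  have [/existsP[i /andP[xi yi]] | split_xy] :=
    boolP (same_block S x y).
    by exists i.
  have row_ge0 z : 0 <= \sum_(w | ~~ same_block S z w)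
      `|adjmx C G (enum_rank z) (enum_rank w)| ^+ 2.
    by apply: sumr_ge0 => w _; rewrite exprn_ge0.
  have /eqP := psumr_eq0P (fun z _ => row_ge0 z) lost0 (i := x) isT.
  rewrite psumr_eq0; last by move=> w _; rewrite exprn_ge0.
  move/allP/(_ y (mem_index_enum y)); rewrite split_xy !mxE !enum_rankK xy /=.
  by rewrite normr1 expr1n oner_eq0.
congr (_ + _); apply: big1 => x _; apply: big1 => y split_xy.
rewrite !mxE !enum_rankK (_ : edge x y = false) ?normr0 ?expr0n //.
apply: contraNF split_xy => /covered[i [xi yi _]].
by apply/existsP; exists i; rewrite xi.
Qed.

End Graph.

End Energy.

Theorem theorem2 (C : numClosedFieldType) (G : sgraph) (k : nat)
    (S : 'I_k -> {set G})
    (disjS : forall i j : 'I_k, i != j -> [disjoint S i & S j]) :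
  let equality_in_both :=
    s_plus C G = \sum_(i < k) s_plus C (induced (S i)) /\
    s_minus C G = \sum_(i < k) s_minus C (induced (S i)) in
  [/\ s_plus C G >= \sum_(i < k) s_plus C (induced (S i)),
      s_minus C G >= \sum_(i < k) s_minus C (induced (S i)),
      equality_in_both <-> edges_covered S
    & (forall v : G, v \notin \bigcup_(i < k) S i -> ~ isolated v) ->
      (equality_in_both <-> disjoint_union S)].
Proof.
move=> equality_in_both; have [le_plus le_minus] := sum_energy_le C disjS.
(* If two inequalities add up to an equality, both are equalities. *)
have equalityP : equality_in_both <-> edges_covered S.
  rewrite -(energy_eq_edges_covered C disjS) big_split /=.
  split=> [[-> ->] // | eq_sum]; split; apply: le_anti;
    rewrite ?le_plus ?le_minus ?andbT.
    by rewrite -(lerD2r (s_minus C G)) eq_sum lerD2l.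
  by rewrite -(lerD2l (s_plus C G)) eq_sum lerD2r.
split=> // no_isolated; rewrite equalityP; split=> [covered | []] //; split=> //.
apply/setP => v; rewrite inE; apply/idPn => uncovered_v.
case: (no_isolated v uncovered_v) => w; apply: contra uncovered_v.
by move=> /covered[i [vi _ _]]; apply/bigcupP; exists i.
Qed.
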